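(* Let $M_Q=M_\theta(Q,\mathbf r)$ be a Fano quiver flag variety. Then the coefficient of $z^{-1}$ in the power series expansion (in $z^{-1}$) of $I_{M_Q}(z)$ vanishes.
   Context: Quiver flag varieties. $Q=(Q_0,Q_1)$ is a finite acyclic quiver with a unique source; $Q_0=\{0,1,\dots,\rho\}$, $0$ is the source, and the number $n_{ij}$ of arrows from $i$ to $j$ is zero unless $i<j$. $s(a),t(a)$ are the source and target of an arrow $a$. $\mathbf r=(r_0,\dots,r_\rho)$ is a vector of positive integers with $r_0=1$. $M_\theta(Q,\mathbf r)$ is the GIT quotient of $\mathrm{Rep}(Q,\mathbf r)=\bigoplus_{a\in Q_1}\mathrm{Hom}(\mathbb C^{r_{s(a)}},\mathbb C^{r_{t(a)}})$ by $G=\prod_{i=1}^\rho\mathrm{GL}(r_i)$ (change of basis) with stability condition $\theta(g)=\prod_i\det(g_i)$; $W_i$ is its $i$-th universal bundle, of rank $r_i$. Put $s_i=\sum_{t(a)=i}r_{s(a)}$, $s_i'=\sum_{s(a)=i}r_{t(a)}$. Standing assumptions: $s_i-r_i>0$ for all $i\ge1$, and $Q$ is graph-reduced, i.e. there is no graftable subquiver (no subquiver attached to the rest of the quiver only through a single non-source vertex of dimension $1$, which could be moved to the source without changing the variety); then the ample cone is the positive orthant in the basis $c_1(W_i)$, and $M_\theta(Q,\mathbf r)$ is Fano iff $s_i-s_i'>0$ for all $i$. Abelianisation. $M_{Q^{ab}}$ is the GIT quotient of $\mathrm{Rep}(Q,\mathbf r)$ by the diagonal maximal torus of $G$ (same $\theta$);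 it is the toric quiver flag variety of the quiver $Q^{ab}$ with vertices $0$ and $ij$ ($1\le i\le\rho$, $1\le j\le r_i$), all of dimension $1$, and $n_{ii'}$ arrows from each vertex over $i$ to each vertex over $i'$. Let $D_{ij}$ be the first Chern class of the tautological line bundle at $ij$, $D_0=0$. For $a\in Q_1^{ab}$ let $D_a=D_{t(a)}-D_{s(a)}$. The roots $R$ of $G$ are indexed by ordered pairs $(ij,ik)$, $j\ne k$, with $D_\alpha=D_{ij}-D_{ik}$ (positive if $j<k$, say; $R^+$ is the set of positive roots), and $\omega=\prod_{\alpha\in R^+}D_\alpha$ up to a scalar. $W=\prod_iS_{r_i}$ is the Weyl group. Torus action. $T_Q=\prod_{a\in Q_1}\mathbb C^*$ acts on $\mathrm{Rep}(Q,\mathbf r)$ by scaling the summand of each arrow; it commutes with $G$ and acts on both quotients. $\lambda_a$ are the equivariant parameters (for $a\in Q_1^{ab}$, $\lambda_a$ is the parameter of the arrow of $Q$ from which $a$ arises). $I$-function. Identify $\mathrm{NE}_1(M_{Q^{ab}})\cong\prod_{i,j}\mathbb Z_{\ge0}$, $\tilde d=(d_{ij})$, with $\langle\tilde d,D_{ij}\rangle=d_{ij}$, and project to $\mathrm{NE}_1(M_Q)\cong\mathbb Z_{\ge0}^\rho$ by $\tilde d\mapsto d=(\sum_jd_{ij})_i$. Put $$I_{Q^{ab}}(\tilde d)=\prod_{a\in Q_1^{ab}}\frac{\prod_{m\le0}(D_a+\lambda_a+mz)}{\prod_{m\le\langle\tilde d,D_a\rangle}(D_a+\lambda_a+mz)},\qquad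 I_R(\tilde d)=\prod_{\alpha\in R}\frac{\prod_{m\le\langle\tilde d,D_\alpha\rangle}(D_\alpha+mz)}{\prod_{m\le0}(D_\alpha+mz)}=(-1)^{\epsilon(d)}\frac{\prod_{\alpha\in R^+}(D_\alpha+\langle\tilde d,D_\alpha\rangle z)}{\prod_{\alpha\in R^+}D_\alpha},$$ $\epsilon(d)=\sum_id_i(r_i-1)$ (products over integers $m$; all but finitely many factors cancel). Then $$I_{M_Q}(z)=\sum_{d\in\mathrm{NE}_1(M_Q)}q^d\sum_{\tilde d\mapsto d}I_{Q^{ab}}(\tilde d)I_R(\tilde d).$$ For each $d$ the sum over $\tilde d\mapsto d$ of the numerators is $W$-anti-invariant, hence divisible by $\omega$, and the quotient is regarded as a $T_Q$-equivariant cohomology class on $M_Q$; rational functions of $z$ are expanded as power series in $z^{-1}$. *)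

(* Defs.v *)
From HB Require Import structures.
From mathcomp Require Import all_boot all_order all_fingroup all_algebra.
From mathcomp Require Import generic_quotient ring_quotient fraction boolp.
From mathcomp Require Import mpoly.

Set Implicit Arguments.
Unset Strict Implicit.
Unset Printing Implicit Defensive.

Import GRing.Theory Num.Theory.
Local Open Scope ring_scope.
Local Open Scope quotient_scope.

Lemma addz_absz_ge0 (k : int) : 0 <= k + (absz k)%:Z.
Proof. by rewrite addrC -[k]opprK subr_ge0 abszE opprK -normrN ler_norm. Qed.

Local Notation "x %:F" := (@FracField.tofrac _ x).

Lemma frac_numdenE (R : idomainType) (f : {fraction R}) :
  f * (\d_(repr f))%:F = (\n_(repr f))%:F.
Proof.
set n := \n_ _; set d := \d_ _.
have d0 : d != 0 by apply: denom_ratioP.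
unlock FracField.tofrac; rewrite -{1}[f]reprK.
rewrite -[LHS]FracField.pi_mul; apply/eqmodP.
rewrite /= /FracField.equivf /FracField.mulf !numden_Ratio ?mulf_neq0 ?oner_neq0 //.
by rewrite !mulr1 mulrC.
Qed.

Section Expansion.
Variable K : fieldType.

(* The polynomial part of z^N f is the truncation of z^N times the expansion
   of f in K((z^-1)) to nonnegative powers of z; hence, as soon as 0 <= k + N,
   the coefficient of z^k in f is that of z^(k+N) in this polynomial part.
   [zcoef_fracE] characterises the resulting series.                         *)
Definition zcoef_frac (p q : {poly K}) (k : int) : K :=
  ((p * 'X^(absz k)) %/ q)`_(absz (k + (absz k)%:Z)).

Definition zcoef (k : int) (f : {fraction {poly K}}) : K :=
  zcoef_frac \n_(repr f) \d_(repr f) k.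

Lemma zcoef_frac_shift (p q : {poly K}) (N M j : nat) : q != 0 ->
  ((p * 'X^(N + M)) %/ q)`_(j + M) = ((p * 'X^N) %/ q)`_j.
Proof.
move=> q0; elim: M => [|M IH]; first by rewrite !addn0.
rewrite !addnS exprSr mulrA {1}(divp_eq (p * 'X^(N + M)) q) mulrDl mulrAC.
rewrite divpD mulpK // coefD -IH coefMX /= [X in _ + X]nth_default ?addr0 //.
rewrite size_divp // leq_subLR.
have := ltn_modp (p * 'X^(N + M)) q; rewrite q0.
have [->|r0] := eqVneq ((p * 'X^(N + M)) %% q) 0; first by rewrite mul0r size_poly0.
rewrite size_mulX //; case: (size q) => // n /=; rewrite ltnS => h.
by apply: leq_ltn_trans h _; rewrite addnS ltnS leq_addr.
Qed.

Lemma zcoef_fracN (p q : {poly K}) (k : int) (N j : nat) : q != 0 ->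
  j%:Z = k + N%:Z -> zcoef_frac p q k = ((p * 'X^N) %/ q)`_j.
Proof.
move=> q0 jE; rewrite /zcoef_frac; set A := absz k; set l := absz _.
have lE : l%:Z = k + A%:Z.
  by rewrite /l gez0_abs ?addz_absz_ge0.
rewrite -(zcoef_frac_shift p A N l q0) -(zcoef_frac_shift p N A j q0) addnC.
congr (_`_ _); apply/eqP; rewrite -eqz_nat !PoszD lE jE; apply/eqP.
by rewrite -!addrA [A%:Z + _]addrC.
Qed.

Lemma zcoefE (p q : {poly K}) k : q != 0 ->
  zcoef k (p%:F / q%:F) = zcoef_frac p q k.
Proof.
move=> q0; set f := _ / _; rewrite /zcoef /zcoef_frac.
set n := \n_ _; set d := \d_ _.
have d0 : d != 0 by apply: denom_ratioP.
have fE : f = n%:F / d%:F.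
  by rewrite -[LHS](mulfK (_ : d%:F != 0)) ?tofrac_eq0 // frac_numdenE.
have e : n * q = p * d.
  apply/eqP; rewrite -tofrac_eq !tofracM; apply/eqP.
  move/eqP: fE; rewrite /f eqr_div ?tofrac_eq0 // => /eqP.
  by rewrite mulrC => <-; rewrite mulrC.
rewrite -(divp_pmul2r (n * _) q0 d0) mulrAC e -(divp_pmul2r (p * _) d0 q0).
by rewrite [d * q]mulrC [p * d * _]mulrAC.
Qed.

(* The coefficients of p / q vanish for large positive powers of z, and
   multiplying the series by q gives back p.                                 *)
Lemma zcoef_big (p q : {poly K}) (j : nat) : q != 0 ->
  (size p <= j)%N -> zcoef j%:Z (p%:F / q%:F) = 0.
Proof.
move=> q0 lepj; rewrite zcoefE // (zcoef_fracN p q0 (_ : j%:Z = j%:Z + 0%N%:Z)).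
  rewrite expr0 mulr1 nth_default // size_divp //.
  exact: leq_trans (leq_subr _ _) lepj.
by rewrite addr0.
Qed.

Lemma zcoef_fracE (p q : {poly K}) (k : int) : q != 0 ->
  \sum_(i < size q) q`_i * zcoef (k - (i : nat)%:Z) (p%:F / q%:F)
    = if k is Posz n then p`_n else 0.
Proof.
move=> q0; pose N := (size q + absz k)%N.
have [l lE] : exists l : nat, l%:Z = k + N%:Z.
  exists (absz (k + N%:Z)); rewrite gez0_abs // /N PoszD addrCA.
  by rewrite addr_ge0 // addz_absz_ge0.
have leql : (size q <= l)%N.
  by rewrite -lez_nat lE /N PoszD addrCA lerDl addz_absz_ge0.
transitivity ((p * 'X^N)`_l); last first.
  rewrite coefMXn; case: k @N lE leql => n N lE leql.
    have -> : l = (n + N)%N by apply/eqP; rewrite -eqz_nat lE PoszD.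
    by rewrite ltnNge leq_addl /= addnK.
  suff -> : (l < N)%N by [].
  by rewrite -ltz_nat lE NegzE gtrDr oppr_lt0.
rewrite [in RHS](divp_eq (p * 'X^N) q) coefD [X in _ = _ + X]nth_default; last first.
  by apply: leq_trans leql; apply: ltnW; rewrite ltn_modp.
rewrite addr0 [_ * q]mulrC coefM.
set Q := _ %/ _.
rewrite -(big_mkord xpredT (fun i => q`_i * Q`_(l - i)%N)).
rewrite (big_cat_nat (n := size q)) //=; last exact: leqW.
rewrite [X in _ = _ + X]big_nat [X in _ = _ + X]big1 ?addr0.
  rewrite big_mkord; apply: eq_bigr => i _; congr (_ * _).
  rewrite zcoefE //; apply: zcoef_fracN => //.
  by rewrite -subzn ?lE 1?addrAC //; apply: leq_trans leql; apply: ltnW.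
by move=> i /andP[lei _]; rewrite nth_default ?mul0r.
Qed.

End Expansion.

(* Vertices 0, ..., rho; vertex 0 is a source by src_lt_tgt. *)
Record quiver := Quiver {
  rho : nat;
  arrow : finType;
  src : arrow -> 'I_rho.+1;
  tgt : arrow -> 'I_rho.+1;
  src_lt_tgt : forall a, (src a < tgt a)%N;
  unique_source : forall i, i != ord0 -> exists a, tgt a = i
}.

Definition vertex (Q : quiver) := 'I_(rho Q).+1.

(* The vertices 1, ..., rho are [gauge i] for i : 'I_rho. *)
Definition gauge (Q : quiver) (i : 'I_(rho Q)) : vertex Q := lift ord0 i.

Record dimvec (Q : quiver) := Dimvec {
  dim :> vertex Q -> nat;
  dim_gt0 : forall i, (0 < dim i)%N;
  dim_source : dim ord0 = 1%N
}.

Section QuiverFlag.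
Context {Q : quiver} (r : dimvec Q).

Definition s_in (i : vertex Q) : nat := \sum_(a : arrow Q | tgt a == i) r (src a).
Definition s_out (i : vertex Q) : nat := \sum_(a : arrow Q | src a == i) r (tgt a).

(* The full subquiver on J together with i is attached to the rest of Q only
   through i.  Since 0 is the unique source and Q is acyclic, every arrow
   between i and J then goes from i to J; grafting replaces it by one from 0. *)
Definition graftable (i : vertex Q) (J : {set vertex Q}) : Prop :=
  [/\ i != ord0 /\ r i = 1%N, i \notin J, ord0 \notin J, J != set0
    & forall a : arrow Q,
        (src a \in J -> tgt a \in i |: J) /\ (tgt a \in J -> src a \in i |: J)].

Definition graph_reduced : Prop := forall i J, ~ graftable i J.

(* Pic(M_Q) = Z^rho through the basis c_1(W_i), 1 <= i; W_0 is trivial. *)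
Definition pic := {ffun 'I_(rho Q) -> int}.

Definition c1W (v : vertex Q) : pic := [ffun i => (gauge i == v)%:R].

(* c_1(Hom(W_v, W_w)) *)
Definition c1Hom (v w : vertex Q) : pic := c1W w *+ r v - c1W v *+ r w.

(* The Euler sequence presents the tangent bundle of M_Q as the cokernel of
   \bigoplus_i End(W_i) -> \bigoplus_a Hom(W_s(a), W_t(a)).                  *)
Definition anticanonical : pic :=
  \sum_(a : arrow Q) c1Hom (src a) (tgt a)
    - \sum_(i : 'I_(rho Q)) c1Hom (gauge i) (gauge i).

(* The ample cone of M_Q, for Q graph-reduced with s_i > r_i for all i. *)
Definition ample (L : pic) : Prop := forall i, 0 < L i.

Definition Fano : Prop := ample anticanonical.

Lemma anticanonicalE i :
  anticanonical i = (s_in (gauge i))%:Z - (s_out (gauge i))%:Z.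
Proof.
rewrite /anticanonical [X in _ - X]big1 ?subr0 => [|j _]; last exact: subrr.
rewrite sum_ffunE; under eq_bigr do rewrite !ffunE !ffunMnE !ffunE.
rewrite sumrB /s_in /s_out -2![in RHS]natz !natr_sum; congr (_ - _);
  rewrite [RHS]big_mkcond; apply: eq_bigr => a _; rewrite eq_sym;
  by case: eqP; rewrite ?mul0rn.
Qed.

(* By dim_source there is exactly one vertex over 0. *)
Definition abvert := {i : vertex Q & 'I_(r i)}.
Definition gvert := {v : abvert | tag v != ord0}.

Definition abarrow :=
  {a : arrow Q & ('I_(r (src a)) * 'I_(r (tgt a)))%type}.
Definition absrc (b : abarrow) : abvert :=
  Tagged (fun i : vertex Q => 'I_(r i)) (tagged b).1.
Definition abtgt (b : abarrow) : abvert :=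
  Tagged (fun i : vertex Q => 'I_(r i)) (tagged b).2.

(* Q[D_ij, lambda_a] *)
Definition var := (gvert + arrow Q)%type.
Definition poly_ring := {mpoly rat[#|{: var}|]}.
Local Notation P := poly_ring.

Definition xvar (v : var) : P := 'X_(enum_rank v).
Definition lam (a : arrow Q) : P := xvar (inr a).
Definition D (v : abvert) : P :=
  if insub v is Some g then xvar (inl g) else 0.
Definition D_arrow (b : abarrow) : P := D (abtgt b) - D (absrc b).

Definition is_root (p : gvert * gvert) : bool :=
  (tag (val p.1) == tag (val p.2)) && (p.1 != p.2).
Definition is_pos_root (p : gvert * gvert) : bool :=
  (tag (val p.1) == tag (val p.2)) && (tagged (val p.1) < tagged (val p.2))%N.
Definition D_root (p : gvert * gvert) : P := D (val p.1) - D (val p.2).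
Definition omega : P := \prod_(p | is_pos_root p) D_root p.

(* The unstable locus of the torus quotient is the union over the vertices v
   of the linear subspaces where all the coordinates of the arrows into v
   vanish; M_{Q^ab} is a tower of projective bundles with
     H_T^*(M_{Q^ab}) = Q[D_ij, lambda_a] / (ab_relation v, v != 0).          *)
Definition ab_relation (v : gvert) : P :=
  \prod_(b : abarrow | abtgt b == val v) (D_arrow b + lam (tag b)).

Definition ab_ideal (p : P) : Prop :=
  exists c : gvert -> P, p = \sum_v c v * ab_relation v.

Definition weyl (s : {perm gvert}) : bool :=
  [forall g, tag (val (s g)) == tag (val g)].

Definition weyl_var (s : {perm gvert}) (v : var) : var :=
  match v with inl g => inl (s g) | inr a => inr a end.

Definition weyl_act (s : {perm gvert}) (p : P) : P :=
  p \mPo [tuple xvar (weyl_var s (enum_val k)) | k < #|{: var}|].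

Definition weyl_invariant : pred P :=
  [pred p | [forall s, weyl s ==> (weyl_act s p == p)]].

Lemma weyl_invariantP p :
  reflect (forall s, weyl s -> weyl_act s p = p) (p \in weyl_invariant).
Proof.
apply: (iffP forallP) => h s; first by move=> ws; move: (h s); rewrite ws => /eqP.
by apply/implyP => /h ->.
Qed.

Lemma weyl_invariant_subring : subring_closed weyl_invariant.
Proof.
split=> [|p q /weyl_invariantP hp /weyl_invariantP hq
        |p q /weyl_invariantP hp /weyl_invariantP hq];
  apply/weyl_invariantP => s ws.
- by rewrite /weyl_act rmorph1.
- by rewrite [LHS]rmorphB; congr (_ - _); [exact: hp | exact: hq].
- by rewrite [LHS]rmorphM; congr (_ * _); [exact: hp | exact: hq].
Qed.

HB.instance Definition _ :=
  GRing.isSubringClosed.Build P weyl_invariant weyl_invariant_subring.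

Definition inv_ring := {p : P | p \in weyl_invariant}.
HB.instance Definition _ := [isSub of inv_ring for sval].
HB.instance Definition _ := [Choice of inv_ring by <:].
HB.instance Definition _ := [SubChoice_isSubComNzRing of inv_ring by <:].

(* Martin's theorem: H_T^*(M_Q) is the quotient of the W-invariant part of
   H_T^*(M_{Q^ab}) by the annihilator of omega.                              *)
Definition martin_ideal : pred inv_ring :=
  [pred f | `[< ab_ideal (omega * val f) >]].

Lemma martin_idealP f :
  reflect (ab_ideal (omega * val f)) (f \in martin_ideal).
Proof. exact: asboolP. Qed.

Lemma martin_ideal_zmod : zmod_closed martin_ideal.
Proof.
split=> [|f g /martin_idealP [c cE] /martin_idealP [e eE]]; apply/martin_idealP.
  by exists (fun=> 0); rewrite rmorph0 mulr0 big1 // => v _; rewrite mul0r.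
exists (fun v => c v - e v); rewrite rmorphB mulrBr cE eE -sumrB.
by apply: eq_bigr => v _; rewrite mulrBl.
Qed.

HB.instance Definition _ :=
  GRing.isZmodClosed.Build inv_ring martin_ideal martin_ideal_zmod.

Lemma martin_idealM (f g : inv_ring) :
  g \in martin_ideal -> f * g \in martin_ideal.
Proof.
move=> /martin_idealP [c cE]; apply/martin_idealP.
exists (fun v => val f * c v); rewrite rmorphM mulrCA cE mulr_sumr.
by apply: eq_bigr => v _; rewrite mulrA.
Qed.

Definition HT := {ideal_quot GRing.ZmodClosed.clone inv_ring martin_ideal _}.
HB.instance Definition _ := GRing.Zmodule.on HT.
HB.instance Definition _ := EqQuotient.on HT.

Definition coh_class (f : inv_ring) : HT := \pi_HT f.

Lemma coh_class_eq0 f : (coh_class f == 0) = (f \in martin_ideal).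
Proof.
by rewrite -[f in RHS]subr0 Quotient.idealrBE raddf0.
Qed.

Let one : HT := coh_class 1.
Let mul (x y : HT) : HT := coh_class (repr x * repr y).

Let mulE f g : mul (coh_class f) (coh_class g) = coh_class (f * g).
Proof.
have reprB h : repr (coh_class h) - h \in martin_ideal.
  by rewrite Quotient.idealrBE reprK.
apply/eqP; rewrite -Quotient.idealrBE.
set f' := repr _; set g' := repr _.
have -> : f' * g' - f * g = f' * (g' - g) + g * (f' - f).
  by rewrite !mulrBr [g * f']mulrC [g * f]mulrC addrA subrK.
by apply: rpredD; apply: martin_idealM; apply: reprB.
Qed.

Let mulA : associative mul.
Proof.
move=> x y z; rewrite -[x]reprK -[y]reprK -[z]reprK.
by rewrite -!/(coh_class _) !mulE mulrA.
Qed.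

Let mulC : commutative mul.
Proof. by move=> x y; rewrite /mul mulrC. Qed.

Let mul1 : left_id one mul.
Proof. by move=> x; rewrite -[x]reprK -/(coh_class _) mulE mul1r. Qed.

Let mulDl : left_distributive mul +%R.
Proof.
move=> x y z; rewrite -[x]reprK -[y]reprK -[z]reprK -!/(coh_class _).
by rewrite -[coh_class _ + _](raddfD \pi_HT) -/(coh_class _) !mulE mulrDl [LHS]raddfD.
Qed.

HB.instance Definition _ := GRing.Zmodule_isComPzRing.Build HT mulA mulC mul1 mulDl.

Lemma coh_class_is_zmod_morphism : zmod_morphism coh_class.
Proof. exact: (raddfB \pi_HT). Qed.

Lemma coh_class_is_monoid_morphism : monoid_morphism coh_class.
Proof. by split=> // f g; rewrite -mulE. Qed.

HB.instance Definition _ :=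
  GRing.isZmodMorphism.Build inv_ring HT coh_class coh_class_is_zmod_morphism.
HB.instance Definition _ :=
  GRing.isMonoidMorphism.Build inv_ring HT coh_class coh_class_is_monoid_morphism.

Definition NE := {ffun 'I_(rho Q) -> nat}.
Definition NE_ab := {ffun gvert -> nat}.

(* <dt, D_v>, with <dt, D_0> = 0 *)
Definition pairing (dt : NE_ab) (v : abvert) : int :=
  if insub v is Some g then (dt g)%:Z else 0.
Definition pairing_arrow (dt : NE_ab) (b : abarrow) : int :=
  pairing dt (abtgt b) - pairing dt (absrc b).
Definition pairing_root (dt : NE_ab) (p : gvert * gvert) : int :=
  pairing dt (val p.1) - pairing dt (val p.2).

Definition NE_proj (dt : NE_ab) : NE :=
  [ffun i => \sum_(g : gvert | tag (val g) == gauge i) dt g]%N.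

Definition coef_field := {fraction poly_ring}.
Definition ratfun := {fraction {poly coef_field}}.
Definition zvar : ratfun := ('X : {poly coef_field})%:F.
Definition of_poly (p : P) : ratfun := (((p%:F : coef_field)%:P) : {poly coef_field})%:F.

(* \prod_(m <= n) (x + m z) / \prod_(m <= 0) (x + m z), m ranging over Z *)
Definition mod_factor (x : ratfun) (n : int) : ratfun :=
  match n with
  | Posz k => \prod_(1 <= m < k.+1) (x + zvar *+ m)
  | Negz k => (\prod_(0 <= m < k.+1) (x - zvar *+ m))^-1
  end.

Definition I_Qab (dt : NE_ab) : ratfun :=
  \prod_(b : abarrow)
    (mod_factor (of_poly (D_arrow b + lam (tag b))) (pairing_arrow dt b))^-1.

Definition I_R (dt : NE_ab) : ratfun :=
  \prod_(p | is_root p) mod_factor (of_poly (D_root p)) (pairing_root dt p).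

Definition NE_of_ord n (e : {ffun gvert -> 'I_n}) : NE_ab := [ffun g => e g : nat].

(* The coefficient of q^d.  The fibre of NE_proj over d is finite: all entries
   of its elements are bounded by \sum_i d_i (NE_proj_bound).               *)
Definition I_MQ (d : NE) : ratfun :=
  \sum_(e : {ffun gvert -> 'I_(\sum_i d i).+1} | NE_proj (NE_of_ord e) == d)
    I_Qab (NE_of_ord e) * I_R (NE_of_ord e).

Lemma NE_proj_bound dt d g : NE_proj dt = d -> (dt g <= \sum_i d i)%N.
Proof.
move=> <-; have := valP g; rewrite eq_sym => /unlift_some [i gE _].
rewrite (bigD1 i) //= ffunE (bigD1 g) /= ?gE // -addnA leq_addr //.
Qed.

(* An element of Frac(Q[D_ij, lambda_a]) is regarded as a class on M_Q when it
   is a W-invariant polynomial; such a polynomial is then unique.            *)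
Definition is_coh_class (f : coef_field) (h : HT) : Prop :=
  exists2 c : inv_ring, f = (val c : P)%:F & h = coh_class c.

(* The coefficient of z^k in I_{M_Q}(z) is the power series whose coefficient
   at q^d is h d.                                                            *)
Definition is_z_coef (I : NE -> ratfun) (k : int) (h : NE -> HT) : Prop :=
  forall d, is_coh_class (zcoef k (I d)) (h d).

End QuiverFlag.

(* Main.v *)
(* Over a Weyl-invariant common denominator whose leading coefficient in z is a
   nonzero rational number, omega * I_{M_Q}(d) has a numerator that is polynomial,
   alternating under the Weyl group and of total degree at most |R^+| - (-K.d) above
   the denominator; hence so are the coefficients of its expansion in 1/z.  By the
   Fano condition -K.d >= |d| = \sum_i d_i.  If |d| >= 2, then omega times the
   coefficient of z^-1 is alternating of degree < |R^+|, and such a polynomial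
   vanishes: in each of its monomials the exponents over a given vertex are distinct.
   If |d| = 1, say d_i = 1, each summand has z-degree at most r_i - 1 - s_i <= -2,
   and if d = 0 there is no dependence on z. *)
Require Import Defs.
From mathcomp Require Import all_boot all_order all_fingroup all_algebra.
From mathcomp Require Import fraction boolp mpoly zify ring.

Set Implicit Arguments.
Unset Strict Implicit.
Unset Printing Implicit Defensive.

Import Order.TTheory GRing.Theory Num.Theory.
Local Open Scope ring_scope.
(** * Alternating products of differences *)

Section DifferenceProduct.
Variables (T : finType) (I : eqType) (tg : T -> I) (key : T -> nat).
Hypothesis tg_key_inj : forall g h, tg g = tg h -> key g = key h -> g = h.

Definition increasing (p : T * T) : bool :=
  (tg p.1 == tg p.2) && (key p.1 < key p.2)%N.

(** One Vandermonde product for each block of equal tag, multiplied together. *)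
Definition diff_prod (A : comPzRingType) (f : T -> A) : A :=
  \prod_(p | increasing p) (f p.1 - f p.2).

(** No key of the block lies strictly between those of [g] and [h], so the swap permutes the other
    increasing pairs and only the factor of [(g, h)] changes sign. *)
Lemma diff_prod_tperm_adjacent (A : comPzRingType) (f : T -> A) g h :
  increasing (g, h) ->
  (forall l, tg l = tg g -> ~~ (key g < key l < key h)%N) ->
  diff_prod (f \o tperm g h) = - diff_prod f.
Proof.
move=> inc_gh adj; rewrite /diff_prod.
rewrite (bigD1 (g, h)) //= [in RHS](bigD1 (g, h)) //= tpermL tpermR.
rewrite -mulNr opprB; congr (_ * _).
pose t (p : T * T) := (tperm g h p.1, tperm g h p.2).
have tK : involutive t by case=> a b; rewrite /t /= !tpermK.
have tS p : increasing p && (p != (g, h)) -> increasing (t p) && (t p != (g, h)).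
  move=> /andP[inc_p p_gh]; apply/andP; split; last first.
    apply: contraTneq inc_p => tp; rewrite -[p]tK tp /t /= tpermL tpermR.
    move: inc_gh; rewrite /increasing /= => /andP[_ lt]; lia.
  case: p inc_p p_gh => a b; rewrite /increasing /= xpair_eqE.
  case/andP: inc_gh => /= /eqP tgh kgh /andP[/eqP tab kab]; move: tab kab.
  case: tpermP => [->|->|/eqP ag /eqP ah]; case: tpermP => [->|->|/eqP bg /eqP bh];
    move=> tab kab nab; rewrite ?eqxx // in nab *; try lia.
  - have := adj b; rewrite -tgh tab eqxx => /(_ erefl).
    have : key b != key h.
      by apply: contraNneq bh => e; apply/eqP/tg_key_inj => //; congruence.
    lia.
  - rewrite -tab -tgh eqxx /=; lia.
  - rewrite tab tgh eqxx /=; lia.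
  - have := adj a; rewrite tab tgh eqxx => /(_ erefl).
    have : key a != key g.
      by apply: contraNneq ag => e; apply/eqP/tg_key_inj => //; congruence.
    lia.
  - by rewrite tab eqxx.
rewrite [RHS](reindex_inj (inv_inj tK)) /=; apply: eq_bigl => p.
by apply/idP/idP => /tS; rewrite ?tK.
Qed.

(* A non-adjacent transposition is a conjugate of a shorter one. *)
Lemma diff_prod_tperm (A : comPzRingType) (f : T -> A) g h :
  tg g = tg h -> g != h -> diff_prod (f \o tperm g h) = - diff_prod f.
Proof.
move=> tgh ngh; wlog kgh : g h tgh ngh / (key g < key h)%N.
  move=> W; case: (ltngtP (key g) (key h)) => [|lt|e]; first exact: W.
    by rewrite tpermC; apply: W => //; rewrite eq_sym.
  by rewrite (tg_key_inj tgh e) eqxx in ngh.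
have [n le_n] : exists n, (key h - key g <= n)%N by exists (key h - key g)%N.
elim: n f g h tgh kgh le_n {ngh} => [|n IH] f g h tgh kgh le_n; first by lia.
have [l /andP[/eqP tl lt]|adj] := pickP [pred l | (tg l == tg g) && (key g < key l < key h)%N].
  (* Three transpositions with smaller key gaps, hence three signs. *)
  have -> : f \o tperm g h = ((f \o tperm l h) \o tperm g l) \o tperm l h.
    apply: funext => x /=; congr f.
    have lg : l != g by apply/eqP => e; subst; lia.
    have lh : l != h by apply/eqP => e; subst; lia.
    have gh : g != h by apply/eqP => e; subst; lia.
    have := tpermJ g l (tperm l h); rewrite tpermL tpermD // 1?eq_sym //.
    move=> <-; rewrite /conjg !permM tpermV //.
  by rewrite !IH ?opprK; try congruence; lia.
apply: diff_prod_tperm_adjacent; first by rewrite /increasing /= tgh eqxx.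
by move=> l tl; have := adj l; rewrite /= tl eqxx /= => ->.
Qed.

(** Count the pairs by their larger entry with respect to [m]: since [m] is injective on each block,
    at most [m h] elements of the block of [h] lie below [h]. *)
Lemma card_increasing_le (m : T -> nat) :
  (forall g h, tg g = tg h -> m g = m h -> g = h) ->
  (#|[pred p | increasing p]| <= \sum_g m g)%N.
Proof.
move=> m_inj.
(* Reversing the pairs that miss [P2] is injective on [P1], because [P1] never contains both a pair
   and its reverse. *)
have swap_le (P1 P2 : pred (T * T)) :
  (forall p, P1 p -> P2 p || P2 (p.2, p.1)) -> (forall p, P1 p -> ~~ P1 (p.2, p.1)) ->
  (#|P1| <= #|P2|)%N.
  move=> h12 h1; pose c p := if P2 p then p else (p.2, p.1).
  rewrite -(card_in_image (f := c) (A := P1)).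
    apply: subset_leq_card; apply/subsetP => q /imageP [p P1p ->].
    rewrite /c unfold_in; case: ifP => // nP2; by have := h12 p P1p; rewrite nP2.
  move=> [a b] [a' b'] P1p P1q; rewrite /c.
  case: ifP => _; case: ifP => _ //=; case=> e1 e2; subst => //.
    by move: (h1 _ P1q) => /=; rewrite (P1p : P1 _).
  by move: (h1 _ P1p) => /=; rewrite (P1q : P1 _).
(* Ordering each pair by [key] or by [m] gives the same number of pairs. *)
pose mpos (p : T * T) := (tg p.1 == tg p.2) && (m p.1 < m p.2)%N.
apply: (@leq_trans #|mpos|).
  apply: swap_le => [[a b]|[a b]]; rewrite /increasing /mpos /=.
    move=> /andP[/eqP tab kab]; rewrite tab eqxx /=.
    by have := m_inj a b tab; case: ltngtP => //= e /(_ e) eab; subst; lia.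
  lia.
rewrite -sum1_card (eq_bigl (fun p => mpos (p.1, p.2))); last by case.
rewrite -(pair_big_dep xpredT (fun a b => mpos (a, b)) (fun _ _ => 1%N)).
rewrite (exchange_big_dep xpredT) //=.
apply: leq_sum => h _; rewrite sum1_card -[leqLHS]/#|[pred g | mpos (g, h)]|.
have [m0|] := posnP (m h).
  by rewrite eq_card0 // => g; rewrite !inE /mpos /= m0 ltn0 andbF.
case mk: (m h) => [//|k] _; rewrite -[leqRHS]card_ord.
rewrite -(card_in_image (f := fun g => inord (m g) : 'I_k.+1)) ?max_card //.
move=> g g'; rewrite !inE /mpos /= mk => /andP[/eqP e1 l1] /andP[/eqP e2 l2] e.
by apply: m_inj; [congruence|]; move/(congr1 val): e; rewrite /= !inordK.
Qed.

End DifferenceProduct.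
(** * Alternating polynomials and expansions in 1/z *)

(* The expansion of p / q is computed from the top by solving
   q * (p / q) = p for its coefficients. *)
Lemma zcoef_closed (K : fieldType) (p q : {poly K}) (G : int -> K -> Prop) :
  q != 0 -> (forall k, G k 0) -> (forall k x y, G k x -> G k y -> G k (x - y)) ->
  (forall k : nat, G (k%:Z - (size q).-1%:Z) (p`_k / lead_coef q)) ->
  (forall (i : nat) k x, (i < (size q).-1)%N -> G k x ->
     G (k + i%:Z - (size q).-1%:Z) (q`_i * x / lead_coef q)) ->
  forall k, G k (zcoef k (FracField.tofrac p / FracField.tofrac q)).
Proof.
move=> q0 G0 GB Gp Gq k; pose c k := zcoef k (FracField.tofrac p / FracField.tofrac q).
rewrite -/(c k).
set n := (size q).-1 in Gp Gq *.
have size_q : size q = n.+1 by rewrite prednK ?lt0n ?size_poly_eq0.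
(* Downward induction: [t] bounds how far [k] lies below [size p], and from [size p] on every
   coefficient vanishes. *)
have [t] : exists t : nat, (size p)%:Z - t%:Z <= k.
  exists (size p + absz k)%N; lia.
elim: t k => [|t IH] k le_k.
  have [j kj] : exists j : nat, k = j%:Z by exists (absz k); lia.
  by rewrite kj /c zcoef_big //; lia.
have := zcoef_fracE p (k + n%:Z) q0; rewrite size_q big_ord_recr /= addrK -/(c k).
rewrite -[q`_n]/(lead_coef q) => E.
have lq0 : lead_coef q != 0 by rewrite lead_coef_eq0.
have -> : c k = (if k + n%:Z is Posz j then p`_j else 0) / lead_coef q
    - \sum_(i < n) q`_i * c (k + n%:Z - (i : nat)%:Z) / lead_coef q.
  by rewrite -mulr_suml -mulrBl -E addrAC subrr add0r mulrC mulKf.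
apply: (GB).
  case kn: (k + n%:Z) => [j|j]; last by rewrite mul0r.
  by have -> : k = j%:Z - n%:Z; [rewrite -kn addrK|exact: Gp].
elim/big_ind: _ => [//|x y Gx Gy|i _].
  by rewrite -[y]opprK; apply: (GB) => //; rewrite -sub0r; apply: GB.
have := Gq i (k + n%:Z - (i : nat)%:Z) (c (k + n%:Z - (i : nat)%:Z)) (ltn_ord i).
rewrite subrK addrK; apply; apply: IH; have := ltn_ord i; lia.
Qed.

Section DegreeFiltration.
Variables (n : nat) (R : idomainType).
Implicit Types (u v : {mpoly R[n]}) (p q : {poly {mpoly R[n]}}) (e f : int).

(** The bound is an integer, so that powers of z can be subtracted freely; a negative one forces
    [u = 0]. *)
Definition deg_le e u : Prop := forall m, m \in msupp u -> (mdeg m)%:Z <= e.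

Lemma deg_leW e f u : e <= f -> deg_le e u -> deg_le f u.
Proof. by move=> ef ue m /ue h; apply: le_trans ef. Qed.

Lemma deg_le0 e : deg_le e 0.
Proof. by move=> m; rewrite msupp0. Qed.

Lemma deg_leB e u v : deg_le e u -> deg_le e v -> deg_le e (u - v).
Proof. by move=> ue ve m /msuppB_le; rewrite mem_cat => /orP[/ue|/ve]. Qed.

Lemma deg_leD e u v : deg_le e u -> deg_le e v -> deg_le e (u + v).
Proof. by move=> ue ve m /msuppD_le; rewrite mem_cat => /orP[/ue|/ve]. Qed.

Lemma deg_leM e f u v : deg_le e u -> deg_le f v -> deg_le (e + f) (u * v).
Proof.
move=> ue vf m /msuppM_le /allpairsP [[m1 m2] /= [m1u m2v ->]].
by rewrite mdegD PoszD lerD ?ue ?vf.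
Qed.

Lemma deg_leC c : deg_le 0 c%:MP.
Proof. by move=> m; rewrite msuppC; case: eqP => // _; rewrite inE => /eqP->; rewrite mdeg0. Qed.

Lemma deg_leX i : deg_le 1 'X_i.
Proof. by move=> m; rewrite msuppX inE => /eqP->; rewrite mdeg1. Qed.

(** Total degree with z counted in degree one. *)
Definition pdeg_le e p : Prop := forall i : nat, deg_le (e - i%:Z) p`_i.

Lemma pdeg_leW e f p : e <= f -> pdeg_le e p -> pdeg_le f p.
Proof. by move=> ef pe i; apply: deg_leW (pe i); lia. Qed.

Lemma pdeg_le0 e : pdeg_le e 0.
Proof. by move=> i; rewrite coef0; exact: deg_le0. Qed.

Lemma pdeg_leB e p q : pdeg_le e p -> pdeg_le e q -> pdeg_le e (p - q).
Proof. by move=> pe qe i; rewrite coefB; apply: deg_leB. Qed.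

Lemma pdeg_leD e p q : pdeg_le e p -> pdeg_le e q -> pdeg_le e (p + q).
Proof. by move=> pe qe i; rewrite coefD; apply: deg_leD. Qed.

Lemma pdeg_leM e f p q : pdeg_le e p -> pdeg_le f q -> pdeg_le (e + f) (p * q).
Proof.
move=> pe qf i; rewrite coefM; elim/big_ind: _ => [|u v|j _].
- exact: deg_le0.
- exact: deg_leD.
by apply: deg_leW (deg_leM (pe j) (qf (i - j)%N)); have := ltn_ord j; lia.
Qed.

Lemma pdeg_leC e u : deg_le e u -> pdeg_le e u%:P.
Proof. by move=> ue i; rewrite coefC; case: eqP => [->|_]; rewrite ?subr0 //; exact: deg_le0. Qed.

Lemma pdeg_le1 : pdeg_le 0 1.
Proof. by apply: pdeg_leC; rewrite -mpolyC1; apply: deg_leC. Qed.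

Lemma pdeg_le_prod (I : Type) (r : seq I) (P : pred I) (F : I -> {poly {mpoly R[n]}})
    (e : I -> int) :
  (forall i, P i -> pdeg_le (e i) (F i)) ->
  pdeg_le (\sum_(i <- r | P i) e i) (\prod_(i <- r | P i) F i).
Proof. by move=> h; elim/big_ind2: _ => [|? ? ? ?|//]; [exact: pdeg_le1|exact: pdeg_leM]. Qed.

Lemma pdeg_le_sum (I : Type) (r : seq I) (P : pred I) (F : I -> {poly {mpoly R[n]}}) e :
  (forall i, P i -> pdeg_le e (F i)) -> pdeg_le e (\sum_(i <- r | P i) F i).
Proof. by move=> h; elim/big_ind: _ => //; [exact: pdeg_le0|exact: pdeg_leD]. Qed.

End DegreeFiltration.

Section Alternating.
Variables (T : finType) (I : eqType) (tg : T -> I) (key : T -> nat).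
Variables (n : nat) (R : numDomainType) (var : T -> 'I_n).
Hypothesis var_inj : injective var.
Implicit Types (u v : {mpoly R[n]}).

Definition alternating u : Prop :=
  forall g h, tg g = tg h -> g != h -> msym (tperm (var g) (var h)) u = - u.

Definition swap_invariant u : Prop :=
  forall g h, tg g = tg h -> g != h -> msym (tperm (var g) (var h)) u = u.

(* The exponents of the variables over a given tag are distinct in every
   monomial of an alternating polynomial. *)
Lemma alternating_eq0 e u : alternating u -> deg_le e u ->
  e < #|[pred p | increasing tg key p]|%:Z -> u = 0.
Proof.
move=> alt_u ue lt_e; apply/mpolyP => m; rewrite mcoeff0; apply/eqP.
rewrite mcoeff_eq0; apply/negP => mu.
suff: (#|[pred p | increasing tg key p]| <= mdeg m)%N by have := ue m mu; lia.
apply: leq_trans (_ : \sum_g m (var g) <= _)%N; last first.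
  rewrite mdegE -(big_imset (fun i => m i)) /=; last by move=> g h _ _ /var_inj.
  by rewrite [leqRHS](bigID (mem (var @: T))) /= leq_addr.
apply: card_increasing_le => // g h tgh mgh; apply/eqP/negPn/negP => ngh.
(* With two equal exponents the swap fixes [m], so the coefficient of [m] equals its own
   negative. *)
have ms : [multinom m (tperm (var g) (var h) i) | i < n] = m.
  by apply/mnmP => i; rewrite mnmE; case: tpermP => [->|->|].
have := congr1 (mcoeff m) (alt_u g h tgh ngh); rewrite mcoeff_sym ms mcoeffN => /eqP.
by rewrite -addr_eq0 -mulr2n mulrn_eq0 /= mcoeff_eq0 mu.
Qed.

End Alternating.
(** * Modification factors *)

Section ModularFactor.
Variables (F : fieldType) (z : F).

(* [mod_factor] is the case z = zvar. *)
Definition modfac (x : F) (n : int) : F :=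
  match n with
  | Posz k => \prod_(1 <= m < k.+1) (x + z *+ m)
  | Negz k => (\prod_(0 <= m < k.+1) (x - z *+ m))^-1
  end.

Lemma modfac0 x : modfac x 0 = 1.
Proof. by rewrite /= big_geq. Qed.

(** For [n <= 0] the inverses are plain products, so only the factors with positive [m] must be
    invertible and [x] itself may vanish. *)
Lemma modfac_pred x n : (forall m : nat, (0 < m)%N -> x + z *+ m != 0) ->
  (modfac x (n - 1))^-1 = (modfac x n)^-1 * (x + z *~ n).
Proof.
move=> nz; case: n => [[|k]|k].
- by rewrite sub0r /= big_nat1 big_geq // invrK invr1 mul1r mulr0n subr0 mulr0z addr0.
- rewrite (_ : k.+1%:Z - 1 = k) /=; last by lia.
  by rewrite [in RHS]big_nat_recr //= invfM mulfVK // nz.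
rewrite (_ : Negz k - 1 = Negz k.+1) /=; last by lia.
by rewrite !invrK big_nat_recr.
Qed.

(** Going down from [M], each unit step contributes one linear factor, on both sides of zero; the
    multiplier does not depend on [t]. *)
Lemma modfac_ratio x (M t : nat) : (forall m : nat, (0 < m)%N -> x + z *+ m != 0) ->
  (modfac x (M%:Z - t%:Z))^-1 * \prod_(1 <= m < M.+1) (x + z *+ m)
    = \prod_(i < t) (x + z *~ (M%:Z - i%:Z)).
Proof.
move=> nz; elim: t => [|t IH].
  rewrite subr0 big_ord0 mulVf //= prodf_seq_neq0; apply/allP => m.
  by rewrite mem_index_iota => /andP[m0 _]; exact: nz.
rewrite big_ord_recr -IH /= (_ : M%:Z - t.+1%:Z = M%:Z - t%:Z - 1); last by lia.
by rewrite modfac_pred // mulrAC.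
Qed.

(** The factors of opposite roots telescope: for [n >= 0], passing to [n + 1] multiplies by
    [x + (n+1)z] and divides by [-(x + nz)]. Negative [n] reduces to this by exchanging [x] and
    [- x]. *)
Lemma modfac_pair x n : (forall m : int, x + z *~ m != 0) ->
  modfac x n * modfac (- x) (- n) * x = (-1) ^+ absz n * (x + z *~ n).
Proof.
have posE y k : (forall m : int, y + z *~ m != 0) ->
  modfac y k%:Z * modfac (- y) (- k%:Z) * y = (-1) ^+ k * (y + z *~ k).
  move=> nz; elim: k => [|k IH].
    by rewrite oppr0 !modfac0 !mul1r mulr0z addr0.
  have nzP m : (0 < m)%N -> y + z *+ m != 0 by have := nz m.
  have nzN m : (0 < m)%N -> - y + z *+ m != 0.
    have := nz (- m%:Z); rewrite mulrNz -pmulrn -oppr_eq0 opprB addrC => h _.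
    exact: h.
  have -> : modfac y k.+1 = modfac y k * (y + z *~ k.+1) by rewrite /= big_nat_recr.
  have -> : modfac (- y) (- k.+1%:Z) = - modfac (- y) (- k%:Z) / (y + z *~ k).
    have /(congr1 GRing.inv) := modfac_pred (- k%:Z) nzN.
    rewrite invrK invfM invrK (_ : - k%:Z - 1 = - k.+1%:Z) => [->|]; last by lia.
    by rewrite mulrNz -opprD invrN mulrN mulNr.
  have := nz k; move: IH.
  set a := modfac _ _; set b := modfac _ _; set c := y + _; set e := y + _.
  move=> IH c0; transitivity (- (a * b * y) * e / c); first by ring.
  by rewrite IH exprS mulN1r mulNr mulrAC mulNr mulfK // mulNr.
move=> nz; case: (intP n) => [|k|k]; try exact: posE.
have nzN m : - x + z *~ m != 0.
  by have := nz (- m); rewrite mulrNz -oppr_eq0 opprB addrC.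
have := posE (- x) k.+1 nzN; rewrite !opprK abszN mulrNz => e.
apply: oppr_inj; rewrite -!mulrN opprB [- x + _]addrC in e *.
by rewrite -e [modfac x _ * _]mulrC.
Qed.

End ModularFactor.
(** * Degrees on a quiver *)

Section QuiverCombinatorics.
Variables (Q : quiver) (r : dimvec Q).
Implicit Types (dt : NE_ab r) (g h : gvert r) (v w : abvert r) (b : abarrow r).

(** With [gtag] as tag and [gkey] as key, the increasing pairs are the positive roots. *)
Definition gtag g : vertex Q := tag (val g).
Definition gkey g : nat := tagged (val g).

Lemma abvert_eq v w : tag v = tag w -> tagged v = tagged w :> nat -> v = w.
Proof.
case: v w => i x [j y] /= ij; case: j / ij y => y xy.
by congr existT; apply: val_inj.
Qed.

Lemma gtag_gkey_inj g h : gtag g = gtag h -> gkey g = gkey h -> g = h.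
Proof. by move=> tgh kgh; apply/val_inj/abvert_eq. Qed.

Lemma sum_tagged (F : abvert r -> int) :
  \sum_v F v = \sum_i \sum_x F (Tagged (fun i : vertex Q => 'I_(r i)) (x : 'I_(r i))).
Proof.
rewrite (sig_big_dep xpredT (fun _ _ => true)
  (fun i (x : 'I_(r i)) => F (Tagged (fun i : vertex Q => 'I_(r i)) x))) /=.
by apply: eq_bigr => [[i x]].
Qed.

(** Over an arrow of [Q] into [i], each vertex over [i] receives one arrow from every vertex over
    the source, so [s_i] arrows in total. *)
Lemma big_abtgt (G : abvert r -> int) :
  \sum_b G (abtgt b) = \sum_v G v * (s_in r (tag v))%:Z.
Proof.
rewrite -(sig_big_dep xpredT (fun _ _ => true)
  (fun a (x : 'I_(r (src a)) * 'I_(r (tgt a))) =>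
     G (Tagged (fun i : vertex Q => 'I_(r i)) x.2))) /=.
rewrite sum_tagged.
under eq_bigr => a _ do
  rewrite -(pair_big xpredT xpredT (fun _ y => G (Tagged (fun i : vertex Q => 'I_(r i)) y))) /=
    sumr_const card_ord.
rewrite (partition_big (@tgt Q) xpredT) //=; apply: eq_bigr => i _.
rewrite -mulr_suml /s_in -natz natr_sum mulr_sumr.
by apply: eq_bigr => a /eqP <-; rewrite mulr_natr.
Qed.

Lemma big_absrc (G : abvert r -> int) :
  \sum_b G (absrc b) = \sum_v G v * (s_out r (tag v))%:Z.
Proof.
rewrite -(sig_big_dep xpredT (fun _ _ => true)
  (fun a (x : 'I_(r (src a)) * 'I_(r (tgt a))) =>
     G (Tagged (fun i : vertex Q => 'I_(r i)) x.1))) /=.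
rewrite sum_tagged.
under eq_bigr => a _ do
  rewrite -(pair_big xpredT xpredT (fun x _ => G (Tagged (fun i : vertex Q => 'I_(r i)) x))) /=
    exchange_big /= sumr_const card_ord.
rewrite (partition_big (@src Q) xpredT) //=; apply: eq_bigr => i _.
rewrite -mulr_suml /s_out -natz natr_sum mulr_sumr.
by apply: eq_bigr => a /eqP <-; rewrite mulr_natr.
Qed.

Lemma big_abvert (A : nmodType) (G : abvert r -> A) :
  (forall v, tag v = ord0 -> G v = 0) -> \sum_v G v = \sum_(g : gvert r) G (val g).
Proof.
move=> G0; rewrite (bigID (fun v => tag v != ord0)) /= addrC big1 ?add0r; last first.
  by move=> v /negPn/eqP/G0.
pose f : gvert r -> abvert r := val.
pose f' v : option (gvert r) := insub v.
rewrite (reindex_omap f f') /=; last first.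
  by move=> v v0; rewrite /f'; case: insubP => [g _ <- //|]; rewrite v0.
by apply: eq_bigl => g; rewrite (valP g : tag (f g) != ord0) (valK g : f' (f g) = Some g) eqxx.
Qed.

Lemma pairing_val dt g : pairing dt (val g) = (dt g)%:Z.
Proof. by rewrite /pairing valK. Qed.

Lemma pairing_source dt v : tag v = ord0 -> pairing dt v = 0.
Proof. by move=> v0; rewrite /pairing insubF // v0 eqxx. Qed.

Lemma gtagP g : exists i, gtag g = gauge i.
Proof. by have := valP g; rewrite eq_sym => /unlift_some [i gi _]; exists i. Qed.

Lemma sum_NE_proj dt : (\sum_i NE_proj dt i = \sum_g dt g)%N.
Proof.
rewrite [RHS](eq_bigl (fun g => gtag g \in [set gauge i | i : 'I_(rho Q)])); last first.
  by move=> g; have [i ->] := gtagP g; rewrite imset_f.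
rewrite (partition_big gtag (fun j => j \in [set gauge i | i : 'I_(rho Q)])) //=.
rewrite big_imset /=; last by move=> i j _ _; apply: lift_inj.
apply: eq_bigr => i _; rewrite ffunE; apply: eq_bigl => g.
by rewrite -/(gtag g); case: eqP => [->|_]; rewrite ?andbF // imset_f.
Qed.

(** By [anticanonicalE] the right-hand side is the anticanonical degree of the class to which [dt]
    projects. *)
Lemma sum_pairing_arrow dt :
  \sum_b pairing_arrow dt b =
    \sum_g (dt g)%:Z * ((s_in r (gtag g))%:Z - (s_out r (gtag g))%:Z).
Proof.
rewrite sumrB big_abtgt big_absrc !big_abvert => [|v /pairing_source->|v /pairing_source->];
  rewrite ?mul0r // -sumrB.
by apply: eq_bigr => g _; rewrite pairing_val mulrBr.
Qed.

(** The Fano condition bounds each integer [s_i - s_i'] below by 1. *)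
Lemma Fano_sum_pairing dt : Fano r ->
  (\sum_g dt g)%:Z <= \sum_b pairing_arrow dt b.
Proof.
move=> hF; rewrite sum_pairing_arrow -natz natr_sum; apply: ler_sum => g _.
have [i gi] := gtagP g; have := hF i; rewrite anticanonicalE -gi natz => h.
by rewrite ler_peMr //; lia.
Qed.

Lemma card_abtgt v : #|[pred b | abtgt b == v]| = s_in r (tag v).
Proof.
have := big_abtgt (fun w => (w == v)%:R).
rewrite [in RHS](bigD1 v) //= eqxx mul1r [X in _ + X]big1 ?addr0; last first.
  by move=> w /negPf->; rewrite mul0r.
rewrite -natr_sum natz => -[<-]; rewrite -sum1_card big_mkcond /=.
by apply: eq_bigr => b _; rewrite inE; case: eqP.
Qed.

Lemma abarrow_tag_lt b : (tag (absrc b) < tag (abtgt b))%N.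
Proof. by case: b => a x; exact: src_lt_tgt. Qed.

End QuiverCombinatorics.

(** * Fractions in z and their coefficients *)

Section FractionsInZ.
Variable A : idomainType.
Hypothesis intrA_eq0 : forall n : int, (n%:~R == 0 :> A) = (n == 0).
Implicit Types (p q : {poly A}) (x : A) (n : int).

(** Numerators and denominators are kept over [A], where total degrees and the Weyl action make
    sense, and are compared with the I-function through this embedding. *)
Definition frac_poly : {rmorphism {poly A} -> {fraction {poly {fraction A}}}} :=
  @FracField.tofrac _ \o map_poly (@FracField.tofrac A).

Lemma tofrac_inj : injective (@FracField.tofrac A).
Proof. by move=> x y /eqP; rewrite tofrac_eq => /eqP. Qed.

Lemma size_map_tofrac p : size (map_poly (@FracField.tofrac A) p) = size p.
Proof. by apply: size_map_inj_poly; [exact: tofrac_inj|rewrite tofrac0]. Qed.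

Lemma frac_poly_eq0 p : (frac_poly p == 0) = (p == 0).
Proof. by rewrite tofrac_eq0 -!size_poly_eq0 size_map_tofrac. Qed.

Definition lin x n : {poly A} := x%:P + 'X *~ n.

Lemma coef_lin x n i : (lin x n)`_i = if i == 0%N then x else if i == 1%N then n%:~R else 0.
Proof.
rewrite coefD coefC coefMrz coefX; case: i => [|[|i]] /=.
- by rewrite mul0rz addr0.
- by rewrite add0r.
- by rewrite mul0rz addr0.
Qed.

Lemma lin_eq0 x n : (lin x n == 0) = (x == 0) && (n == 0).
Proof.
apply/eqP/andP => [e|[/eqP-> /eqP->]]; last by rewrite /lin mulr0z addr0.
have e0 := coef_lin x n 0; have e1 := coef_lin x n 1.
by rewrite e !coef0 /= in e0 e1; rewrite -e0 -intrA_eq0 -e1 eqxx.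
Qed.

Lemma frac_poly_lin x n : frac_poly (lin x n) = frac_poly x%:P + frac_poly 'X *~ n.
Proof. by rewrite rmorphD rmorphMz. Qed.

Lemma frac_poly_ratio x n (M : nat) : n <= M%:Z ->
  (modfac (frac_poly 'X) (frac_poly x%:P) n)^-1
      * frac_poly (\prod_(1 <= m < M.+1) lin x m%:Z)
    = frac_poly (\prod_(i < absz (M%:Z - n)) lin x (M%:Z - (i : nat)%:Z)).
Proof.
move=> le_M; rewrite !rmorph_prod.
under [in RHS]eq_bigr do rewrite frac_poly_lin.
under [X in _ * X]eq_bigr do rewrite frac_poly_lin -pmulrn.
rewrite -modfac_ratio.
  by congr ((modfac _ _ _)^-1 * _); lia.
by move=> m m0; rewrite pmulrn -frac_poly_lin frac_poly_eq0 lin_eq0 negb_and; lia.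
Qed.

Lemma frac_poly_pair x n : x != 0 ->
  modfac (frac_poly 'X) (frac_poly x%:P) n * modfac (frac_poly 'X) (frac_poly (- x)%:P) (- n)
      * frac_poly x%:P
    = frac_poly ((-1) ^+ absz n * lin x n).
Proof.
move=> x0; rewrite polyCN rmorphN rmorphM rmorphXn rmorphN1 frac_poly_lin; apply: modfac_pair => m.
by rewrite -frac_poly_lin frac_poly_eq0 lin_eq0 negb_and x0.
Qed.

End FractionsInZ.
(** A constant denominator leaves a polynomial in z. *)
Lemma zcoefN1_size1 (K : fieldType) (p q : {poly K}) : size q = 1%N ->
  zcoef (-1) (FracField.tofrac p / FracField.tofrac q) = 0.
Proof.
move=> q1; have q0 : q != 0 by rewrite -size_poly_eq0 q1.
have := zcoef_fracE p (-1) q0; rewrite q1 big_ord1 subr0 => /eqP.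
rewrite mulf_eq0 => /orP[|/eqP //].
by have := lead_coef_eq0 q; rewrite lead_coefE q1 => ->; rewrite (negPf q0).
Qed.

(** The fraction has degree at most -2 in z. *)
Lemma zcoefN1_small (K : fieldType) (p q : {poly K}) : ((size p).+1 < size q)%N ->
  zcoef (-1) (FracField.tofrac p / FracField.tofrac q) = 0.
Proof.
move=> pq; have q0 : q != 0 by rewrite -size_poly_gt0; apply: leq_trans pq.
rewrite zcoefE // /zcoef_frac expr1 divp_small ?coef0 //.
have [->|p0] := eqVneq p 0; last by rewrite size_mulX.
by rewrite mul0r size_poly0 size_poly_gt0.
Qed.

(** * Expansions of alternating fractions *)

Section AlternatingExpansion.
Variables (T : finType) (I : eqType) (tg : T -> I) (key : T -> nat).
Variables (n : nat) (R : numFieldType) (var : T -> 'I_n).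
Hypothesis var_inj : injective var.
Local Notation P := {mpoly R[n]}.
Local Notation alternating := (alternating tg var).
Local Notation invariant := (swap_invariant tg var).
Local Notation "x %:F" := (@FracField.tofrac P x).

(** Solving for the coefficients of the expansion divides only by the constant [c]. Multiplied by
    [w], they therefore stay alternating polynomials, of degree at most [e] minus the z-degree of
    [q] minus [k], which is too small for a nonzero one. *)
Lemma zcoef_alternating_eq0 (p q : {poly P}) (w : P) (c : R) (e k : int) :
  w != 0 -> c != 0 -> lead_coef q = c%:MP ->
  (forall i, alternating p`_i) -> (forall i, invariant q`_i) ->
  pdeg_le (size q).-1%:Z q -> pdeg_le e p ->
  e - (size q).-1%:Z - k < #|[pred p | increasing tg key p]|%:Z ->
  zcoef k (frac_poly P p / frac_poly P (q * w%:P)) = 0.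
Proof.
move=> w0 c0 lcq altp invq degq degp lt_e.
set F := map_poly (@FracField.tofrac P).
have wF0 : w%:F != 0 by rewrite tofrac_eq0.
(* Moving [w] into the numerator leaves a denominator with constant leading coefficient. *)
have -> : frac_poly P p / frac_poly P (q * w%:P) =
    FracField.tofrac ((w%:F)^-1 *: F p) / FracField.tofrac (F q).
  have q0 : q != 0 by rewrite -lead_coef_eq0 lcq mpolyC_eq0.
  have Fq0 : FracField.tofrac (F q) != 0.
    by rewrite tofrac_eq0 -size_poly_eq0 size_map_tofrac size_poly_eq0.
  have Fw : frac_poly P (q * w%:P) = FracField.tofrac (F q) * FracField.tofrac (w%:F)%:P.
    by rewrite rmorphM /= map_polyC.
  rewrite Fw invfM mulrA mulrAC; congr (_ / _).
  apply: (mulIf (_ : FracField.tofrac (w%:F)%:P != 0)).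
    by rewrite tofrac_eq0 polyC_eq0.
  rewrite mulfVK ?tofrac_eq0 ?polyC_eq0 // -rmorphM mulrC mul_polyC scalerA.
  by rewrite divff // scale1r.
pose G (k : int) (x : {fraction P}) := exists u : P,
  [/\ w%:F * x = u%:F, alternating u & deg_le (e - (size q).-1%:Z - k) u].
suff: G k (zcoef k (FracField.tofrac ((w%:F)^-1 *: F p) / FracField.tofrac (F q))).
  case=> u [wx altu degu]; have u0 := alternating_eq0 var_inj altu degu lt_e.
  by apply/(mulfI wF0); rewrite wx mulr0 u0 tofrac0.
have size_F : size (F q) = size q by exact: size_map_tofrac.
have lcF : lead_coef (F q) = (c%:MP)%:F.
  by rewrite lead_coefE size_F coef_map -lcq.
have lcFV (x : {fraction P}) : x / lead_coef (F q) = (c^-1%:MP)%:F * x.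
  rewrite lcF mulrC; congr (_ * _); apply: (mulfI (_ : (c%:MP)%:F != 0)).
    by rewrite tofrac_eq0 mpolyC_eq0.
  by rewrite divff ?tofrac_eq0 ?mpolyC_eq0 // -rmorphM -mpolyCM divff.
have scale_alt (a : R) u : alternating u -> alternating (a%:MP * u).
  by move=> altu g h tgh ngh; rewrite mul_mpolyC msymZ altu // scalerN.
have scale_deg (a : R) f u : deg_le f u -> deg_le f (a%:MP * u).
  by move=> du; rewrite -[f]add0r; apply: deg_leM du; apply: deg_leC.
apply: zcoef_closed.
- by rewrite -size_poly_eq0 size_F size_poly_eq0 -lead_coef_eq0 lcq mpolyC_eq0.
- move=> j; exists 0; split; first by rewrite mulr0 tofrac0.
    by move=> g h _ _; rewrite msym0 oppr0.
  exact: deg_le0.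
- move=> j x y [u [wx altu degu]] [v [wy altv degv]]; exists (u - v); split.
  + by rewrite mulrBr wx wy tofracB.
  + by move=> g h tgh ngh; rewrite msymB altu // altv // opprB opprK addrC.
  + exact: deg_leB.
- move=> j; exists (c^-1%:MP * p`_j); split; last first.
  + by apply: scale_deg; rewrite size_F; apply: deg_leW (degp j); lia.
  + exact: scale_alt.
  + by rewrite lcFV coefZ coef_map tofracM mulrCA (mulrA w%:F) divff // mul1r.
move=> i j x lti [u [wx altu degu]]; exists (c^-1%:MP * (q`_i * u)); split.
- by rewrite lcFV coef_map !tofracM -wx mulrCA (mulrCA w%:F).
- apply: scale_alt => g h tgh ngh.
  by rewrite msymM invq // altu // mulrN.
- apply: scale_deg; rewrite size_F; apply: deg_leW (deg_leM (degq i) degu); lia.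
Qed.

End AlternatingExpansion.

Lemma pdeg_le_lin (n : nat) (R : idomainType) (u : {mpoly R[n]}) (m : int) :
  deg_le 1 u -> pdeg_le 1 (lin u m).
Proof.
move=> du i; rewrite coef_lin; case: eqP => [->|_]; first by rewrite subr0.
case: eqP => [->|_]; last exact: deg_le0.
by rewrite subrr -[m%:~R](rmorph_int (@mpolyC n R)); apply: deg_leC.
Qed.

(** * Degrees in z of products of linear forms *)

Section LinearProducts.
Variable A : idomainType.

Lemma map_lin (f : {rmorphism A -> A}) x n : map_poly f (lin x n) = lin (f x) n.
Proof. by rewrite rmorphD rmorphMz /= map_polyC map_polyX. Qed.

Lemma size_lin_le (x : A) n : (size (lin x n) <= (n != 0).+1)%N.
Proof.
apply/leq_sizeP => j jn; rewrite coef_lin.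
case: j jn => [|[|j]] //=; case: eqP => // -> _; first by rewrite mulr0z.
Qed.

Lemma size_lin (x : A) n : n%:~R != 0 :> A -> size (lin x n) = 2%N.
Proof.
move=> n0; apply/eqP; rewrite eqn_leq; apply/andP; split.
  by apply: leq_trans (size_lin_le _ _) _; case: (n != 0).
by rewrite ltnNge; apply/negP => /leq_sizeP /(_ 1%N isT) /eqP; rewrite coef_lin /= (negPf n0).
Qed.

Lemma lead_coef_lin (x : A) n : n%:~R != 0 :> A -> lead_coef (lin x n) = n%:~R.
Proof. by move=> n0; rewrite lead_coefE size_lin // coef_lin. Qed.

Lemma size_prod_le (I : Type) (s : seq I) (P : pred I) (F : I -> {poly A}) (d : I -> nat) :
  (forall i, P i -> size (F i) <= (d i).+1)%N ->
  (size (\prod_(i <- s | P i) F i)%R <= (\sum_(i <- s | P i) d i).+1)%N.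
Proof.
move=> h; elim/big_ind2: _ => [|p k q l hp hq|//]; first by rewrite size_poly1.
by apply: leq_trans (size_polyMleq _ _) _; lia.
Qed.

Lemma size_prod_eq (I : Type) (s : seq I) (P : pred I) (F : I -> {poly A}) (d : I -> nat) :
  (forall i, P i -> size (F i) = (d i).+1) ->
  size (\prod_(i <- s | P i) F i) = (\sum_(i <- s | P i) d i).+1.
Proof.
move=> h; elim/big_ind2: _ => [|p k q l hp hq|//]; first by rewrite size_poly1.
by rewrite size_mul -?size_poly_eq0 ?hp ?hq //=; lia.
Qed.

End LinearProducts.
(** * Numerators and denominators of the I-function *)

Section Numerators.
Variables (Q : quiver) (r : dimvec Q).
Implicit Types (dt : NE_ab r) (g h : gvert r) (v w : abvert r) (b : abarrow r).
Local Notation P := (poly_ring r).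
Local Notation emb := (frac_poly P).

Lemma intr_poly_ring_eq0 (n : int) : (n%:~R == 0 :> P) = (n == 0).
Proof. by rewrite -[n%:~R](rmorph_int (@mpolyC _ rat)) mpolyC_eq0 intr_eq0. Qed.

Definition arrow_form b : P := D_arrow b + lam r (tag b).

Definition vert_lin dt v : {poly P} := lin (D v) (pairing dt v).

(* As soon as M bounds the pairings, num_arrow M dt b / den_arrow M b is the factor
   of the arrow b in I_Qab dt; the denominator does not depend on dt. *)
Definition num_arrow (M : nat) dt b : {poly P} :=
  \prod_(i < absz (M%:Z - pairing_arrow dt b)) lin (arrow_form b) (M%:Z - (i : nat)%:Z).

Definition den_arrow (M : nat) b : {poly P} :=
  \prod_(1 <= m < M.+1) lin (arrow_form b) m%:Z.

(** The product of [D_alpha + <dt, D_alpha> z] over the positive roots, written so that its sign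
    under a transposition follows from [diff_prod_tperm]. *)
Definition root_num dt : {poly P} :=
  diff_prod (@gtag Q r) (@gkey Q r) (fun g => vert_lin dt (val g)).

(* Has the parity of the sum of the pairings with the positive roots, hence of
   epsilon(d), and is visibly invariant under the Weyl group. *)
Definition root_sign dt : nat := (\sum_(p : gvert r * gvert r | is_root p) dt p.1)%N.

Definition numer (M : nat) dt : {poly P} :=
  (-1) ^+ root_sign dt * (\prod_b num_arrow M dt b) * root_num dt.

Definition denom (M : nat) : {poly P} := \prod_b den_arrow M b.

Lemma of_polyE (u : P) : of_poly u = emb u%:P.
Proof. by rewrite /of_poly -map_polyC. Qed.

Lemma zvarE : zvar r = emb 'X.
Proof. by rewrite /zvar -(map_polyX (@FracField.tofrac P)). Qed.

Lemma mod_factorE (u : P) n : mod_factor (of_poly u) n = modfac (emb 'X) (emb u%:P) n.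
Proof. by rewrite -of_polyE -zvarE. Qed.

Lemma mod_factor_pair (u : P) n : u != 0 ->
  mod_factor (of_poly u) n * mod_factor (of_poly (- u)) (- n) * emb u%:P =
  emb ((-1) ^+ absz n * lin u n).
Proof.
move=> u0; apply: etrans (frac_poly_pair intr_poly_ring_eq0 n u0).
exact: (congr2 (fun y y' => y * y' * emb u%:P) (mod_factorE u n) (mod_factorE (- u) (- n))).
Qed.

Lemma I_Qab_numE dt (M : nat) : (forall b, pairing_arrow dt b <= M%:Z) ->
  I_Qab dt * emb (denom M) = emb (\prod_b num_arrow M dt b).
Proof.
move=> le_M; rewrite /I_Qab /denom !rmorph_prod -big_split.
apply: eq_bigr => b _; rewrite mod_factorE.
exact: (frac_poly_ratio intr_poly_ring_eq0).
Qed.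

Lemma gvert_neq g h : gtag g = gtag h -> (g != h) = (gkey g != gkey h).
Proof.
move=> tgh; have [->|ngh] := eqVneq g h; first by rewrite eqxx.
by apply/esym; apply: contraNneq ngh => /(gtag_gkey_inj tgh)->.
Qed.

(** A root is either positive or the reverse of a positive one. *)
Lemma big_roots (B : Type) (idx : B) (op : Monoid.com_law idx)
    (F : gvert r * gvert r -> B) :
  \big[op/idx]_(p | is_root p) F p =
  \big[op/idx]_(p | increasing (@gtag Q r) (@gkey Q r) p) op (F p) (F (p.2, p.1)).
Proof.
rewrite big_split /= (bigID (increasing (@gtag Q r) (@gkey Q r))) /=; congr (op _ _).
  apply: eq_bigl => -[g h]; rewrite /is_root /increasing /= -/(gtag g) -/(gtag h).
  by case: eqP => //= tgh; rewrite (gvert_neq tgh); lia.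
pose swap (p : gvert r * gvert r) := (p.2, p.1).
have swapK : involutive swap by case.
rewrite (reindex_inj (inv_inj swapK)) /=.
apply: eq_bigl => -[g h]; rewrite /is_root /increasing /= -/(gtag g) -/(gtag h) [gtag h == _]eq_sym.
by case: eqP => //= tgh; rewrite eq_sym (gvert_neq tgh); lia.
Qed.

Lemma D_val g : D (val g) = 'X_(enum_rank (inl g : var r)).
Proof. by rewrite /D valK. Qed.

Lemma D_inj g h : D (val g) = D (val h) -> g = h.
Proof.
rewrite !D_val => /(congr1 (mcoeff U_(enum_rank (inl g : var r)))).
rewrite !mcoeffX eqxx eq_mnm1; case: eqP => [/enum_rank_inj [->] //|_ /eqP].
by rewrite oner_eq0.
Qed.

Lemma root_numE dt : root_num dt =
  \prod_(p | increasing (@gtag Q r) (@gkey Q r) p) lin (D_root p) (pairing_root dt p).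
Proof.
apply: eq_bigr => p _; rewrite /vert_lin /lin /D_root /pairing_root polyCB mulrzBr.
by rewrite opprD addrACA.
Qed.

(** Opposite roots are taken together by [mod_factor_pair]; the denominators that remain multiply to
    [omega]. *)
Lemma I_R_numE dt :
  I_R dt * emb (omega r)%:P = emb ((-1) ^+ root_sign dt * root_num dt).
Proof.
rewrite /I_R big_roots /omega rmorph_prod rmorph_prod -big_split.
rewrite root_numE /root_sign big_roots -[X in X * _]prodrXr -big_split rmorph_prod.
apply: eq_bigr => -[g h] /andP[/eqP tgh kgh].
set x := D_root (g, h); set n := pairing_root dt (g, h).
transitivity (mod_factor (of_poly x) n * mod_factor (of_poly (- x)) (- n) * emb x%:P).
  by rewrite -[D_root (h, g)]opprB -[pairing_root dt (h, g)]opprB.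
have x0 : x != 0.
  by rewrite subr_eq0; apply/eqP => /D_inj /= e; move: kgh; rewrite /= e ltnn.
rewrite mod_factor_pair //.
(* [dt g - dt h] and [dt g + dt h] have the same parity. *)
congr (emb (_ * _)); rewrite -signr_odd -[RHS]signr_odd; congr ((-1) ^+ (_ : bool)).
rewrite /n /pairing_root !pairing_val /=; lia.
Qed.

Lemma pairing_arrow_le dt (M : nat) b : (forall g, dt g <= M)%N ->
  pairing_arrow dt b <= M%:Z.
Proof.
move=> dtM; have bound v : 0 <= pairing dt v <= M%:Z.
  by rewrite /pairing; case: insubP => // g _ _; rewrite lez_nat dtM.
have /andP[_ hi] := bound (abtgt b); have /andP[lo _] := bound (absrc b).
by rewrite /pairing_arrow; lia.
Qed.

(** [M] bounds all entries in the fibre, so [denom M] times [omega] is a common denominator for the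
    summands. *)
Lemma I_MQ_numE (d : @NE Q) (M := (\sum_i d i)%N) :
  @I_MQ Q r d * emb (denom M * (omega r)%:P) =
  emb (\sum_(e : {ffun gvert r -> 'I_M.+1} | NE_proj (NE_of_ord e) == d)
         numer M (NE_of_ord e)).
Proof.
rewrite /I_MQ mulr_suml rmorph_sum; apply: eq_bigr => e _.
rewrite rmorphM mulrACA I_Qab_numE => [|b]; last first.
  by apply: pairing_arrow_le => g; rewrite ffunE -ltnS.
by rewrite I_R_numE -rmorphM /numer mulrCA mulrA.
Qed.

Lemma omega_neq0 : omega r != 0.
Proof.
apply/prodf_neq0 => -[g h] /andP[_ kgh]; rewrite subr_eq0.
by apply/eqP => /D_inj /= e; move: kgh; rewrite /= e ltnn.
Qed.

End Numerators.
(** * Weyl symmetry *)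

Section WeylSymmetry.
Variables (Q : quiver) (r : dimvec Q).
Implicit Types (dt : NE_ab r) (v w : abvert r) (b : abarrow r).
Local Notation P := (poly_ring r).

Definition gvar (k : gvert r) : 'I_#|{: var r}| := enum_rank (inl k : var r).

Lemma gvar_inj : injective gvar.
Proof. by move=> k l /enum_rank_inj []. Qed.

Lemma abarrow_eq b b' :
  tag b = tag b' -> absrc b = absrc b' -> abtgt b = abtgt b' -> b = b'.
Proof.
case: b b' => a [x y] [a' [x' y']] /= aa'; case: a' / aa' x' y' => x' y'.
rewrite /absrc /abtgt /= => /(congr1 (fun v => tagged v : nat)) /= xx'.
move=> /(congr1 (fun v => tagged v : nat)) /= yy'.
by rewrite (val_inj xx') (val_inj yy').
Qed.

Lemma abarrow_ex a v w : tag v = src a -> tag w = tgt a ->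
  exists b : abarrow r, [/\ tag b = a, absrc b = v & abtgt b = w].
Proof.
case: v w => i x [j y] /= ei ej; subst i j.
by exists (Tagged (fun a => 'I_(r (src a)) * 'I_(r (tgt a)))%type (x, y)).
Qed.

(** The permutation lifts to the arrows, since an arrow over [a] is determined by its ends and every
    choice of ends over those of [a] occurs. *)
Lemma reindex_abarrow (s : {perm abvert r}) (B : Type) (idx : B) (op : Monoid.com_law idx)
    (F : arrow Q -> abvert r -> abvert r -> B) : (forall v, tag (s v) = tag v) ->
  \big[op/idx]_b F (tag b) (s (absrc b)) (s (abtgt b)) =
  \big[op/idx]_b F (tag b) (absrc b) (abtgt b).
Proof.
move=> s_tag.
have /choice [f fP] b : exists b' : abarrow r,
    [/\ tag b' = tag b, absrc b' = s (absrc b) & abtgt b' = s (abtgt b)].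
  by apply: abarrow_ex; rewrite s_tag.
have f_inj : injective f.
  move=> b b' e; have [t1 s1 g1] := fP b; have [t2 s2 g2] := fP b'.
  by apply: abarrow_eq; [|apply: (@perm_inj _ s)..]; congruence.
rewrite [RHS](reindex_inj f_inj); apply: eq_bigr => b _.
by have [-> -> ->] := fP b.
Qed.

Section Transposition.
Variables (g h : gvert r).
Hypothesis tgh : gtag g = gtag h.
Hypothesis ngh : g != h.

Definition act : P -> P := msym (tperm (gvar g) (gvar h)).

Lemma gtag_tperm k : gtag (tperm g h k) = gtag k.
Proof. by case: tpermP => [->|->|]. Qed.

Lemma tag_tperm v : tag (tperm (val g) (val h) v) = tag v.
Proof. by case: tpermP => [->|->|] //; exact: esym tgh. Qed.

Lemma tperm_val k : tperm (val g) (val h) (val k) = val (tperm g h k).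
Proof. by rewrite (inj_tperm _ _ _ val_inj). Qed.

Lemma act_var (x : var r) :
  act (xvar x) = 'X_(tperm (gvar g) (gvar h) (enum_rank x)).
Proof.
rewrite /act /xvar msymX; congr mpolyX; apply/mnmP => i; rewrite mnmE !mnm1E tpermV.
by rewrite -(inj_eq (@perm_inj _ (tperm (gvar g) (gvar h)))) tpermK.
Qed.

Lemma act_D v : act (D v) = D (tperm (val g) (val h) v).
Proof.
have [v0|v0] := boolP (tag v != ord0); last first.
  have E u : tag u = ord0 -> D u = 0 by move=> u0; rewrite /D insubF // u0 eqxx.
  by move/negPn/eqP: v0 => v0; rewrite !E ?tag_tperm // /act msym0.
pose k : gvert r := Sub v v0; have -> : v = val k by [].
rewrite tperm_val !D_val; have := act_var (inl k); rewrite /xvar => ->.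
by rewrite -/(gvar k) -(inj_tperm _ _ _ gvar_inj).
Qed.

Lemma act_lam a : act (lam r a) = lam r a.
Proof.
rewrite /lam act_var /xvar tpermD // (inj_eq enum_rank_inj) //.
Qed.

Definition swap_NE dt : NE_ab r := [ffun k => dt (tperm g h k)].

Lemma pairing_swap dt v : pairing (swap_NE dt) (tperm (val g) (val h) v) = pairing dt v.
Proof.
have [v0|v0] := boolP (tag v != ord0); last first.
  by move/negPn/eqP: v0 => v0; rewrite !pairing_source ?tag_tperm.
pose k : gvert r := Sub v v0; have -> : v = val k by [].
by rewrite tperm_val !pairing_val ffunE tpermK.
Qed.

Definition act_poly : {rmorphism {poly P} -> {poly P}} :=
  map_poly (msym (tperm (gvar g) (gvar h))).

Lemma act_poly_lin x n : act_poly (lin x n) = lin (act x) n.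
Proof. exact: map_lin. Qed.

(** Permuting the variables and permuting the degree both relabel the ends of the arrows, which only
    reorders the product. [F] is left general so as to serve numerators and denominators alike. *)
Lemma act_arrows (F : P -> int -> {poly P}) dt :
  (forall x n, act_poly (F x n) = F (act x) n) ->
  act_poly (\prod_b F (arrow_form b) (pairing_arrow dt b)) =
  \prod_b F (arrow_form b) (pairing_arrow (swap_NE dt) b).
Proof.
move=> actF; rewrite rmorph_prod.
pose G a v w := F (D w - D v + lam r a) (pairing (swap_NE dt) w - pairing (swap_NE dt) v).
rewrite -[RHS]/(\prod_b G (tag b) (absrc b) (abtgt b)).
rewrite -(reindex_abarrow _ G tag_tperm); apply: eq_bigr => b _.
rewrite actF /G !pairing_swap -!act_D -[lam r _ in RHS]act_lam.
by rewrite /act -msymB -msymD.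
Qed.

Lemma act_root_num dt : act_poly (root_num dt) = - root_num (swap_NE dt).
Proof.
rewrite -(diff_prod_tperm (@gtag_gkey_inj _ r) _ tgh ngh) /root_num /diff_prod rmorph_prod.
apply: eq_bigr => p _; rewrite rmorphB.
rewrite -[RHS]/(vert_lin (swap_NE dt) (val (tperm g h p.1))
  - vert_lin (swap_NE dt) (val (tperm g h p.2))).
by rewrite /vert_lin !act_poly_lin !act_D -!tperm_val !pairing_swap.
Qed.

Lemma root_sign_swap dt : root_sign (swap_NE dt) = root_sign dt.
Proof.
pose sp (p : gvert r * gvert r) := (tperm g h p.1, tperm g h p.2).
have spK : involutive sp by case=> k l; rewrite /sp /= !tpermK.
rewrite /root_sign (reindex_inj (inv_inj spK)); apply: eq_big => [[k l]|[k l] _] /=.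
  by rewrite /is_root /= -!/(gtag _) !gtag_tperm (inj_eq perm_inj).
by rewrite ffunE tpermK.
Qed.

Lemma act_numer M dt : act_poly (numer M dt) = - numer M (swap_NE dt).
Proof.
rewrite /numer !rmorphM rmorphXn rmorphN1 act_root_num root_sign_swap mulrN.
congr (- (_ * _ * _)).
apply: (act_arrows (F := fun x n => \prod_(i < absz (M%:Z - n)) lin x (M%:Z - (i : nat)%:Z))).
by move=> x n; rewrite rmorph_prod; apply: eq_bigr => i _; rewrite act_poly_lin.
Qed.

Lemma act_denom M : act_poly (denom r M) = denom r M.
Proof.
(* This [F] is constant in the pairing; the zero degree is a placeholder. *)
apply: (act_arrows (F := fun x n => \prod_(1 <= m < M.+1) lin x m%:Z) [ffun=> 0%N]).
by move=> x n; rewrite rmorph_prod; apply: eq_bigr => i _; rewrite act_poly_lin.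
Qed.

Lemma NE_proj_swap dt : NE_proj (swap_NE dt) = NE_proj dt.
Proof.
apply/ffunP => i; rewrite !ffunE (reindex_inj (@perm_inj _ (tperm g h))).
apply: eq_big => [k|k _]; last by rewrite ffunE tpermK.
by rewrite -!/(gtag _) gtag_tperm.
Qed.

(** The swap permutes the fibre over [d], and each numerator goes to minus that of the swapped
    degree. *)
Lemma act_sum_numer (d : @NE Q) (M : nat) :
  let S := \sum_(e : {ffun gvert r -> 'I_M.+1} | NE_proj (NE_of_ord e) == d)
    numer M (NE_of_ord e) in
  act_poly S = - S.
Proof.
move=> S; pose se (e : {ffun gvert r -> 'I_M.+1}) := [ffun k => e (tperm g h k)].
have seK : involutive se by move=> e; apply/ffunP => k; rewrite !ffunE tpermK.
have seE e : NE_of_ord (se e) = swap_NE (NE_of_ord e).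
  by apply/ffunP => k; rewrite !ffunE.
rewrite /S rmorph_sum [in RHS](reindex_inj (inv_inj seK)) -sumrN.
apply: eq_big => [e|e _]; first by rewrite seE NE_proj_swap.
by rewrite seE; apply: act_numer.
Qed.

End Transposition.
End WeylSymmetry.
(** * Degree bounds *)

Section Bounds.
Variables (Q : quiver) (r : dimvec Q).
Implicit Types (dt : NE_ab r) (g h : gvert r) (v w : abvert r) (b : abarrow r).
Local Notation P := (poly_ring r).
Local Notation incr := (increasing (@gtag Q r) (@gkey Q r)).

Lemma deg_le_D v : deg_le 1 (D v).
Proof. by rewrite /D; case: insub => [g|]; [exact: deg_leX|exact: deg_le0]. Qed.

Lemma deg_le_arrow_form b : deg_le 1 (arrow_form b).
Proof.
apply: deg_leD; last exact: deg_leX.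
by apply: deg_leB; exact: deg_le_D.
Qed.

Lemma intr_pos_neq0 (m : nat) : (0 < m)%N -> m%:Z%:~R != 0 :> P.
Proof. by move=> m0; rewrite intr_poly_ring_eq0; lia. Qed.

Lemma size_den_arrow M b : size (den_arrow M b) = M.+1.
Proof.
rewrite /den_arrow big_nat_cond (size_prod_eq _ (d := fun=> 1%N)); last first.
  by move=> m /andP[/andP[m0 _] _]; rewrite size_lin // intr_pos_neq0.
by rewrite -big_nat_cond sum_nat_const_nat muln1 subn1.
Qed.

Lemma size_denom M : size (denom r M) = (#|{: abarrow r}| * M).+1.
Proof.
rewrite /denom (size_prod_eq _ (d := fun=> M)) => [|b _]; last exact: size_den_arrow.
by rewrite sum_nat_const.
Qed.

(** Each form [x + m z] has leading coefficient [m], so [c] is a power of [M!]. This permits the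
    division in the expansion. *)
Lemma lead_coef_denom M : exists2 c : rat, c != 0 & lead_coef (denom r M) = c%:MP.
Proof.
pose C (u : P) := exists2 c : rat, c != 0 & u = c%:MP.
have C1 : C 1 by exists 1; rewrite ?oner_eq0 ?mpolyC1.
have CM u u' : C u -> C u' -> C (u * u').
  by move=> [c c0 ->] [c' c'0 ->]; exists (c * c'); rewrite ?mulf_neq0 ?mpolyCM.
rewrite -/(C _) /denom lead_coef_prod; elim/big_ind: _ => // b _.
rewrite lead_coef_prod big_nat_cond; elim/big_ind: _ => // m /andP[/andP[m0 _] _].
rewrite lead_coef_lin ?intr_pos_neq0 //; exists m%:Z%:~R; first by rewrite intr_eq0; lia.
by rewrite (rmorph_int (@mpolyC _ rat)).
Qed.

Lemma pdeg_le_denom M : pdeg_le (#|{: abarrow r}| * M)%N (denom r M).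
Proof.
have -> : (#|{: abarrow r}| * M)%N%:Z = \sum_(b : abarrow r) \sum_(1 <= m < M.+1) 1.
  by rewrite sumr_const_nat sumr_const subn1 /= -mulrnA mulnC natz.
apply: pdeg_le_prod => b _; apply: pdeg_le_prod => m _.
exact/pdeg_le_lin/deg_le_arrow_form.
Qed.

(** Count linear factors: [M] minus the pairing for each arrow, and one for each positive root. *)
Lemma pdeg_le_numer M dt : (forall g, dt g <= M)%N ->
  pdeg_le ((#|{: abarrow r}| * M)%N%:Z - \sum_b pairing_arrow dt b + #|[pred p | incr p]|%:Z)
    (numer M dt).
Proof.
move=> dtM; apply: pdeg_leM; last first.
  have -> : #|[pred p | incr p]|%:Z = \sum_(p | incr p) 1.
    by rewrite sumr_const natz.
  apply: pdeg_le_prod => p _.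
  by apply: pdeg_leB; apply/pdeg_le_lin/deg_le_D.
rewrite -[X in pdeg_le X _]add0r; apply: pdeg_leM.
  rewrite -signr_odd; case: odd; rewrite ?expr0 ?expr1; last exact: pdeg_le1.
  by rewrite -[-1]sub0r; apply: pdeg_leB; [exact: pdeg_le0|exact: pdeg_le1].
have -> : (#|{: abarrow r}| * M)%N%:Z - \sum_b pairing_arrow dt b =
    \sum_b \sum_(i < absz (M%:Z - pairing_arrow dt b)) 1.
  rewrite -[(#|_| * M)%N]sum_nat_const -[in LHS]natz natr_sum -sumrB.
  apply: eq_bigr => b _; rewrite sumr_const card_ord !natz.
  by have := pairing_arrow_le b dtM; lia.
apply: pdeg_le_prod => b _; apply: pdeg_le_prod => i _.
exact/pdeg_le_lin/deg_le_arrow_form.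
Qed.

Lemma sum_gtag g : (\sum_(h : gvert r | gtag h == gtag g) 1 = r (gtag g))%N.
Proof.
have [i gi] := gtagP g.
have := @big_abvert Q r int (fun v => (tag v == gtag g)%:R).
rewrite sum_tagged (bigD1 (gtag g)) //= eqxx sumr_const card_ord big1 ?addr0; last first.
  by move=> j /negPf nj; rewrite big1 // => x _; rewrite /= nj.
rewrite -natr_sum !natz => e.
have {e} : (r (gtag g) = \sum_(h : gvert r) (gtag h == gtag g))%N.
  by apply/eqP; rewrite -eqz_nat e // => v ->; rewrite gi.
move->; rewrite big_mkcond; apply: eq_bigr => h _; by case: eqP.
Qed.

(** By [big_roots] the sum counts the roots whose first entry is [g], one for each other vertex over
    the same vertex of [Q]. *)
Lemma sum_roots_at g :
  (\sum_(p | incr p) ((p.1 == g) + (p.2 == g)) = (r (gtag g)).-1)%N.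
Proof.
rewrite -(big_roots _ (fun p => nat_of_bool (p.1 == g))).
rewrite (eq_bigl (fun p : gvert r * gvert r => xpredT p.1 && is_root (p.1, p.2))); last by case.
rewrite -(pair_big_dep xpredT (fun k l : gvert r => is_root (k, l))
  (fun k _ => nat_of_bool (k == g))) /=.
rewrite (bigD1 g) //= [X in (_ + X)%N]big1 ?addn0; last first.
  by move=> k /negPf kg; rewrite big1 // => l _; rewrite kg.
rewrite eqxx -(sum_gtag g) [in RHS](bigD1 g) //= ?add1n /=.
by apply: eq_bigl => h; rewrite /is_root /= -!/(gtag _) [gtag g == _]eq_sym [g == h]eq_sym.
Qed.

(* For a degree d concentrated on one vertex i, the z-degree of the numerators
   drops by s_i on the arrows and grows by at most r_i - 1 on the roots. *)
Lemma size_numer1 dt g : (forall h, dt h = (h == g)) ->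
  (r (gtag g) < s_in r (gtag g))%N -> (size (numer 1 dt) < #|{: abarrow r}|)%N.
Proof.
move=> dtE lt_rs.
have pairE v : pairing dt v = (v == val g)%:Z.
  have [v0|v0] := boolP (tag v != ord0).
    pose k : gvert r := Sub v v0; have -> : v = val k by [].
    by rewrite pairing_val dtE (inj_eq val_inj).
  rewrite pairing_source; last by move/negPn/eqP: v0.
  by case: eqP => // e; move: v0; rewrite e (valP g).
(* Arrows into [g] have pairing 1 and no factor left; every other arrow contributes z-degree at most
   one. *)
pose da b := (1 - (abtgt b == val g))%N.
pose dr (p : gvert r * gvert r) := ((p.1 == g) + (p.2 == g))%N.
have size_arrows : (size (\prod_b num_arrow 1 dt b)%R <= (\sum_b da b).+1)%N.
  apply: size_prod_le => b _; rewrite /num_arrow /pairing_arrow !pairE /da.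
  have ne : (abtgt b == val g) && (absrc b == val g) = false.
    apply/negP => /andP[/eqP e1 /eqP e2]; have := abarrow_tag_lt b.
    by rewrite e1 e2 ltnn.
  move: ne; case: (abtgt b == _); case: (absrc b == _) => // _.
  - by rewrite big_ord0 size_poly1.
  (* Pairing -1 gives two factors, of which the second, with z-coefficient 1 - 1, is constant in
     z. *)
  - rewrite !big_ord_recl big_ord0 mulr1 /=.
    apply: leq_trans (size_polyMleq _ _) _.
    have le2 : (size (lin (arrow_form b) (1%:Z - 0%:Z)) <= 2)%N := size_lin_le _ _.
    have le1 : (size (lin (arrow_form b) (1%:Z - 1%:Z)) <= 1)%N := size_lin_le _ _.
    by rewrite -subn1 leq_subLR; apply: leq_add le2 le1.
  - by rewrite big_ord_recl big_ord0 mulr1; apply: size_lin_le.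
have size_roots : (size (root_num dt) <= (\sum_(p | incr p) dr p).+1)%N.
  rewrite root_numE; apply: size_prod_le => p _; apply: leq_trans (size_lin_le _ _) _.
  rewrite ltnS /pairing_root !pairing_val !dtE /dr.
  by case: (p.1 == g); case: (p.2 == g).
have sum_da : (\sum_b da b + s_in r (gtag g) = #|{: abarrow r}|)%N.
  rewrite -card_abtgt -!sum1_card [X in (_ + X)%N]big_mkcond -big_split /=.
  by apply: eq_bigr => b _; rewrite /da inE; case: (_ == _).
have -> : size (numer 1 dt) = size ((\prod_b num_arrow 1 dt b) * root_num dt).
  by rewrite /numer -mulrA -signr_odd size_Msign.
apply: leq_ltn_trans (size_polyMleq _ _) _.
(* The z-degree is at most the number of arrows minus [s_i] plus [r_i - 1], and [r_i < s_i]. *)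
move: size_arrows size_roots; rewrite sum_roots_at.
have := dim_gt0 r (gtag g); lia.
Qed.

End Bounds.

(** * Vanishing of the coefficient of 1/z *)

Section Vanishing.
Variables (Q : quiver) (r : dimvec Q) (d : @NE Q).
Local Notation P := (poly_ring r).
Local Notation M := (\sum_i d i)%N.

Definition sum_numer : {poly P} :=
  \sum_(e : {ffun gvert r -> 'I_M.+1} | NE_proj (NE_of_ord e) == d) numer M (NE_of_ord e).

Lemma I_MQE :
  @I_MQ Q r d = frac_poly P sum_numer / frac_poly P (denom r M * (omega r)%:P).
Proof.
rewrite -(I_MQ_numE r d) mulfK // frac_poly_eq0 mulf_neq0 ?polyC_eq0 ?omega_neq0 //.
by rewrite -size_poly_eq0 size_denom.
Qed.

Lemma sum_fibre (dt : NE_ab r) : NE_proj dt = d -> (\sum_(g : gvert r) dt g = M)%N.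
Proof. by move=> <-; rewrite sum_NE_proj. Qed.

Lemma size_denom_omega : size (denom r M * (omega r)%:P) = (#|{: abarrow r}| * M).+1.
Proof. by rewrite mulrC mul_polyC size_scale ?omega_neq0 // size_denom. Qed.

Lemma size_sum_numer1 :
  (forall i, (r (gauge i) < s_in r (gauge i))%N) -> M = 1%N ->
  (size sum_numer < #|{: abarrow r}|)%N.
Proof.
move=> hs M1.
have bound (dt : NE_ab r) : NE_proj dt = d -> (size (numer M dt) < #|{: abarrow r}|)%N.
  move=> dtd; have := sum_fibre dtd; rewrite M1 => s1.
  (* A degree of total 1 is concentrated on a single vertex [g], with value 1. *)
  have [g dg] : exists g, (0 < dt g)%N.
    apply/existsP; apply: contra_eqT s1; rewrite negb_exists => /forallP z.
    by rewrite big1 // => g _; have := z g; rewrite lt0n negbK => /eqP.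
  apply: (@size_numer1 _ _ dt g) => [h|]; last by have [i ->] := gtagP g.
  move: s1; rewrite (bigD1 g) //=; have [->|hg] := eqVneq h g; first by lia.
  by rewrite (bigD1 h) //=; lia.
(* The strict bound must also hold for the zero polynomial, so some arrow has to exist: one enters a
   vertex over the support of [d]. *)
have b0 : (0 < #|{: abarrow r}|)%N.
  have [i _] : exists i : 'I_(rho Q), (0 < d i)%N.
    apply/existsP; apply: contra_eqT M1; rewrite negb_exists => /forallP z.
    by rewrite big1 // => i _; have := z i; rewrite lt0n negbK => /eqP.
  pose v : abvert r := Tagged (fun i => 'I_(r i)) (Ordinal (dim_gt0 r (gauge i))).
  apply: leq_trans (max_card [pred b | abtgt b == v]).
  by rewrite card_abtgt; apply: leq_ltn_trans (hs i).
apply: (big_ind (fun p : {poly P} => size p < #|{: abarrow r}|)%N).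
- by rewrite size_poly0.
- by move=> p q hp hq; apply: leq_ltn_trans (size_polyD _ _) _; rewrite gtn_max hp.
by move=> e /eqP; exact: bound.
Qed.

Lemma alternating_sum_numer i : alternating (@gtag Q r) (@gvar Q r) sum_numer`_i.
Proof.
move=> g h tgh ngh; have := congr1 (fun p : {poly P} => p`_i) (act_sum_numer tgh ngh d M).
by rewrite coefN coef_map.
Qed.

Lemma swap_invariant_denom i : swap_invariant (@gtag Q r) (@gvar Q r) (denom r M)`_i.
Proof.
move=> g h tgh ngh; have := congr1 (fun p : {poly P} => p`_i) (act_denom tgh M).
by rewrite coef_map.
Qed.

Lemma pdeg_le_sum_numer : Fano r ->
  pdeg_le ((#|{: abarrow r}| * M)%N%:Z - M%:Z
    + #|[pred p | increasing (@gtag Q r) (@gkey Q r) p]|%:Z) sum_numer.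
Proof.
move=> hF; apply: pdeg_le_sum => e /eqP ed.
apply: pdeg_leW (pdeg_le_numer (M := M) _); last by move=> g; rewrite ffunE -ltnS.
by have := Fano_sum_pairing (NE_of_ord e) hF; rewrite (sum_fibre ed); lia.
Qed.

Lemma zcoefN1_I_MQ : (forall i, (r (gauge i) < s_in r (gauge i))%N) -> Fano r ->
  zcoef (-1) (@I_MQ Q r d) = 0.
Proof.
move=> hs hF; rewrite I_MQE; case: (ltngtP M 1) => M1.
- apply: zcoefN1_size1; rewrite size_map_tofrac size_denom_omega.
  by move: M1; rewrite ltnS leqn0 => /eqP->; rewrite muln0.
(* For [M >= 2], [omega] times the coefficient has degree at most the number of positive roots minus
   [M - 1]. *)
- have [c c0 lc] := lead_coef_denom r M.
  apply: (zcoef_alternating_eq0 (key := @gkey Q r) (@gvar_inj Q r) (omega_neq0 r) c0 lc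
    alternating_sum_numer swap_invariant_denom _ (pdeg_le_sum_numer hF)).
    by rewrite size_denom; exact: pdeg_le_denom.
  by rewrite size_denom; lia.
- apply: zcoefN1_small; rewrite !size_map_tofrac size_denom_omega M1 muln1 ltnS.
  exact: size_sum_numer1.
Qed.

End Vanishing.

Theorem proposition4p5 (Q : quiver) (r : dimvec Q)
    (hs : forall i : 'I_(rho Q), (r (gauge i) < s_in r (gauge i))%N)
    (hred : graph_reduced r)
    (hFano : Fano r) :
  is_z_coef (@I_MQ Q r) (-1) (fun _ => 0).
Proof.
move=> d; exists 0; last by rewrite raddf0.
by rewrite zcoefN1_I_MQ // tofrac0.
Qed.
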